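(* There exists a family $\{\Lambda_A:A>0\}$ of countable subsets of $\mathbb{R}$, each enumerated in strictly increasing order by $\mathbb{Z}$, such that for every $A>0$ $$\sum_{\lambda\in\Lambda_A}\Big|\int_{[0,1]}f(x)e^{-2\pi i\lambda x}\,dx\Big|^2\ge A\int_{[0,1]}|f(x)|^2\,dx\qquad\text{for all } f\in L^2([0,1]),$$ and $$\lim_{A\to\infty}A\,g_{\min}(\Lambda_A)=1.$$
   Context: For a set $\Lambda=\{\lambda_k\}_{k\in\mathbb{Z}}\subset\mathbb{R}$ with $\lambda_n<\lambda_m$ whenever $n<m$, the spectral gaps are $g_k(\Lambda):=\lambda_k-\lambda_{k-1}$, $k\in\mathbb{Z}$. The essential minimal spectral gap is $$g_{\min}(\Lambda):=\inf\{c\ge 0: g_k(\Lambda)<c\text{ for infinitely many }k\}.$$ *)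

(* Defs.v *)
From HB Require Import structures.
From mathcomp Require Import all_boot all_order all_algebra.
From mathcomp Require Import all_classical all_reals all_analysis.
From mathcomp Require Import complex.

Set Implicit Arguments.
Unset Strict Implicit.
Unset Printing Implicit Defensive.

Import Order.TTheory GRing.Theory Num.Theory.
Import numFieldNormedType.Exports.

Local Open Scope classical_set_scope.
Local Open Scope complex_scope.
Local Open Scope ring_scope.

(* The library's `|z| on R[i] has values in R[i]; this is the real modulus. *)
Definition cmod {R : realType} (z : R[i]) : R := ComplexField.Normc.normc z.

Definition cexp {R : realType} (z : R[i]) : R[i] :=
  (expR (complex.Re z))%:C *
    (cos (complex.Im z) +i* sin (complex.Im z)).

Definition cmeasurable {R : realType} (D : set R) (f : R -> R[i]) : Prop :=
  measurable_fun D (fun x => complex.Re (f x)) /\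
  measurable_fun D (fun x => complex.Im (f x)).

Definition cintegral {R : realType} (D : set R) (f : R -> R[i]) : R[i] :=
  (\int[lebesgue_measure]_(x in D) complex.Re (f x))%R +i*
  (\int[lebesgue_measure]_(x in D) complex.Im (f x))%R.

Definition sq_norm2 {R : realType} (D : set R) (f : R -> R[i]) : \bar R :=
  (\int[lebesgue_measure]_(x in D) ((cmod (f x)) ^+ 2)%:E)%E.

(* Complex-valued square-integrable functions, not quotiented by a.e.
   equality.  Measurability is with respect to the Borel sets; every
   Lebesgue class has a Borel representative. *)
Definition L2 {R : realType} (D : set R) (f : R -> R[i]) : Prop :=
  cmeasurable D f /\ (sq_norm2 D f < +oo)%E.

(* D is bounded in the intended use, so that f in L2 D is integrable and the
   integral below is a genuine one. *)
Definition fourier {R : realType} (D : set R) (f : R -> R[i]) (l : R) : R[i] :=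
  cintegral D (fun x => f x * cexp (- ((2 * pi * l * x)%:C * 'i%C))).

Definition increasing_enum {R : realType} (lam : int -> R) (L : set R) : Prop :=
  (forall m n : int, m < n -> lam m < lam n) /\ range lam = L.

Definition gap {R : realType} (lam : int -> R) (k : int) : R :=
  lam k - lam (k - 1).

(* Extended-real-valued: the infimum of the empty set is +oo.  The value is
   determined by the set range lam, since two increasing enumerations of a set
   by the integers differ by a shift. *)
Definition gmin {R : realType} (lam : int -> R) : \bar R :=
  ereal_inf [set c%:E | c in
    [set c : R | 0 <= c /\ infinite_set [set k : int | gap lam k < c]]].

(* Main.v *)
Require Import Defs.
From mathcomp Require Import all_boot all_order all_algebra.
From mathcomp Require Import all_classical all_reals all_analysis.
From mathcomp Require Import measurable_realfun complex.
From mathcomp Require Import ring lra zify.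

Set Implicit Arguments.
Unset Strict Implicit.
Unset Printing Implicit Defensive.

Import Order.TTheory GRing.Theory Num.Theory.
Import numFieldNormedType.Exports.

Local Open Scope classical_set_scope.
Local Open Scope ring_scope.

(* Take [Lam_A = Z / N] with [N] an integer in ]A, A + 1]: all gaps equal
   [1 / N], and [A / N] tends to [1].  Splitting [Z] into residue classes
   modulo [N] splits the sum over [Z / N] into [N] sums over [Z] of the squared
   Fourier coefficients of the modulations [f x * e(- r x / N)], each of which
   is at least the squared norm of [f] by Parseval.

   Parseval's inequality needs the density of trigonometric polynomials in
   [L2 `[0, 1]].  Indicators of intervals are bounded pointwise limits of
   [(1 - p ^ n) ^ (2 ^ n)] with [p] a trigonometric polynomial below [1/2] on
   the interval and above it elsewhere; a Dynkin argument extends this to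
   measurable sets, and dominated convergence to all of [L2]. *)

(** * Unit complex numbers and integer characters *)

Section fourier_exponentials.
Context {R : realType}.
Implicit Types (s t l : R) (z w c : R[i]) (j k : int) (f g : R -> R[i]).

(** Polynomial in the two coordinates, without the square root of [cmod], so that [ring] and [nra]
    apply to it. *)
Definition sqmod z : R := complex.Re z ^+ 2 + complex.Im z ^+ 2.

Lemma cmod_sqr z : cmod z ^+ 2 = sqmod z.
Proof. by case: z => a b; rewrite sqr_sqrtr// addr_ge0 ?sqr_ge0. Qed.

Lemma sqmod_ge0 z : 0 <= sqmod z.
Proof. by rewrite addr_ge0 ?sqr_ge0. Qed.

Lemma sqmodM z w : sqmod (z * w) = sqmod z * sqmod w.
Proof. by case: z => a b; case: w => c d; rewrite /sqmod/=; ring. Qed.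

Definition cis t : R[i] := (cos t +i* sin t)%C.

Lemma cis0 : cis 0 = 1.
Proof. by rewrite /cis cos0 sin0. Qed.

Lemma cisD s t : cis (s + t) = cis s * cis t.
Proof.
by apply/eqP; rewrite eq_complex/= cosD sinD eqxx/= addrC.
Qed.

Lemma cisX t n : cis t ^+ n = cis (t *+ n).
Proof.
elim: n => [|n IH]; first by rewrite expr0 mulr0n cis0.
by rewrite exprS IH mulrS cisD.
Qed.

Lemma sqmod_cis t : sqmod (cis t) = 1.
Proof. exact: cos2Dsin2. Qed.

Lemma cexp_cis t : cexp (- (t%:C%C * 'i%C)) = cis (- t).
Proof.
rewrite /cexp /cis/= !mul0r !mulr0 mulr1 subrr addr0 oppr0 expR0.
by apply/eqP; rewrite eq_complex/= !mul1r !mul0r subr0 addr0 !eqxx.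
Qed.

Definition char k x : R[i] := cis (2 * pi * k%:~R * x).

Lemma charD j k x : char (j + k) x = char j x * char k x.
Proof. by rewrite /char -cisD; congr cis; rewrite intrD; ring. Qed.

Lemma charX n x : char 1 x ^+ n = char n%:Z x.
Proof. by rewrite /char cisX; congr cis; rewrite -mulr_natr -pmulrn; ring. Qed.

End fourier_exponentials.

(** * Square-integrable complex functions on the unit interval *)

Section square_integrable.
Context {R : realType}.
Implicit Types (a b : R) (c : R[i]) (j k : int) (f g : R -> R[i]).
Local Notation mu := (@lebesgue_measure R).
Local Notation I := (`[0%R, 1%R]%classic : set R).

Definition cintegrable f :=
  mu.-integrable I (EFin \o (fun x => complex.Re (f x))) /\
  mu.-integrable I (EFin \o (fun x => complex.Im (f x))).

(** Real-valued, for use in ring identities. [Rintegral] is [0] when the integral is infinite, so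
    the value is meaningful for [f] in [L2], where [sq_norm2_energy] identifies it with
    [sq_norm2]. *)
Definition energy f : R := \int[mu]_(x in I) sqmod (f x).


Lemma mu_unit : mu I = 1%:E.
Proof. by rewrite lebesgue_measure_itv/= lte_fin ltr01 oppr0 adde0. Qed.

Lemma Rintegral_unit_cst (r : R) : \int[mu]_(x in I) (cst r x) = r.
Proof. by rewrite Rintegral_cst//= [lebesgue_measure _]mu_unit/= mulr1. Qed.

Lemma integrable_le (h g : R -> R) : measurable_fun I h ->
  mu.-integrable I (EFin \o g) -> (forall x, I x -> `|h x| <= g x) ->
  mu.-integrable I (EFin \o h).
Proof.
move=> mh ig hg; apply: (le_integrable _ _ _ ig) => //.
  exact/measurable_EFinP.
by move=> x Ix /=; rewrite lee_fin (le_trans (hg _ Ix))// ler_norm.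
Qed.

Lemma integrable_cst_unit (r : R) : mu.-integrable I (EFin \o cst r).
Proof.
apply: measurable_bounded_integrable => //.
- by rewrite [X in (X < _)%E]mu_unit ltry.
- by exists `|r|; split; rewrite ?num_real// => M rM x _ /=; exact: ltW.
Qed.

Lemma integrable_unitZ (r : R) (h : R -> R) : mu.-integrable I (EFin \o h) ->
  mu.-integrable I (EFin \o (fun x => r * h x)).
Proof.
move=> ih; have -> : EFin \o (fun x => r * h x) =
  (fun x => r%:E * (h x)%:E)%E by apply/funext.
exact: integrableZl.
Qed.

Lemma integrable_unitD (g h : R -> R) : mu.-integrable I (EFin \o g) ->
  mu.-integrable I (EFin \o h) ->
  mu.-integrable I (EFin \o (fun x => g x + h x)).
Proof. by move=> ig ih; exact: (integrableD _ ig ih). Qed.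

Lemma measurable_cos_lin a : measurable_fun I (fun x => cos (a * x)).
Proof.
apply: measurable_funTS; apply: continuous_measurable_fun => x.
by apply: continuous_comp; [exact: mulrl_continuous|exact: continuous_cos].
Qed.

Lemma measurable_sin_lin a : measurable_fun I (fun x => sin (a * x)).
Proof.
apply: measurable_funTS; apply: continuous_measurable_fun => x.
by apply: continuous_comp; [exact: mulrl_continuous|exact: continuous_sin].
Qed.

Lemma measurable_sqmod f :
  cmeasurable I f -> measurable_fun I (fun x => sqmod (f x)).
Proof.
by move=> [mr mi]; apply: measurable_funD; exact: measurable_funX.
Qed.

Lemma L2P f : L2 I f <->
  cmeasurable I f /\ mu.-integrable I (EFin \o (fun x => sqmod (f x))).
Proof.
have E : sq_norm2 I f = (\int[mu]_(x in I) `|(sqmod (f x))%:E|)%E.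
  by apply: eq_integral => x _; rewrite cmod_sqr gee0_abs// lee_fin sqmod_ge0.
split=> -[mf nf]; split => //.
- apply/integrableP; split; last by rewrite -E.
  by apply/measurable_EFinP; exact: measurable_sqmod.
- by rewrite E; case/integrableP : nf.
Qed.

Lemma sq_norm2_energy f : L2 I f -> sq_norm2 I f = (energy f)%:E.
Proof.
move=> /L2P[_ nf]; rewrite /energy /Rintegral fineK ?integrable_fin_num//.
by apply: eq_integral => x _; rewrite cmod_sqr.
Qed.

Lemma cmeasurable_mul_cis f a : cmeasurable I f ->
  cmeasurable I (fun x => f x * cis (a * x)).
Proof.
move=> [mr mi]; split.
- rewrite (_ : (fun x => _) = fun x => complex.Re (f x) * cos (a * x) -
    complex.Im (f x) * sin (a * x)); last by apply/funext => x; case: (f x).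
  by apply: measurable_funB; apply: measurable_funM => //;
    [exact: measurable_cos_lin|exact: measurable_sin_lin].
- rewrite (_ : (fun x => _) = fun x => complex.Re (f x) * sin (a * x) +
    complex.Im (f x) * cos (a * x)); last by apply/funext => x; case: (f x).
  by apply: measurable_funD; apply: measurable_funM => //;
    [exact: measurable_sin_lin|exact: measurable_cos_lin].
Qed.

Lemma cmeasurable_cst c : cmeasurable I (cst c).
Proof. by split; exact: measurable_cst. Qed.

Lemma cmeasurableB f g : cmeasurable I f -> cmeasurable I g ->
  cmeasurable I (fun x => f x - g x).
Proof.
move=> [mr mi] [nr ni]; split.
- rewrite (_ : (fun x => _) = fun x => complex.Re (f x) - complex.Re (g x));
    last by apply/funext => x; case: (f x) => ? ?; case: (g x).
  exact: measurable_funB.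
- rewrite (_ : (fun x => _) = fun x => complex.Im (f x) - complex.Im (g x));
    last by apply/funext => x; case: (f x) => ? ?; case: (g x).
  exact: measurable_funB.
Qed.

Lemma sqmodB_le (z w : R[i]) : sqmod (z - w) <= 2 * sqmod z + 2 * sqmod w.
Proof.
case: z => x y; case: w => u v; rewrite /sqmod/=.
have := sqr_ge0 (x + u); have := sqr_ge0 (y + v); nra.
Qed.

Lemma L2_cst c : L2 I (cst c).
Proof.
by apply/L2P; split; [exact: cmeasurable_cst|
  exact: (integrable_cst_unit (sqmod c))].
Qed.

Lemma L2B f g : L2 I f -> L2 I g -> L2 I (fun x => f x - g x).
Proof.
move=> /L2P[mf nf] /L2P[mg ng]; apply/L2P.
have mfg := cmeasurableB mf mg; split => //.
apply: (@integrable_le _ (fun x => 2 * sqmod (f x) + 2 * sqmod (g x))).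
- exact: measurable_sqmod.
- exact: (integrable_unitD (integrable_unitZ 2 nf) (integrable_unitZ 2 ng)).
- by move=> x _; rewrite ger0_norm ?sqmod_ge0// sqmodB_le.
Qed.

Lemma L2_mul_cis f a : L2 I f -> L2 I (fun x => f x * cis (a * x)).
Proof.
move=> /L2P[mf nf]; apply/L2P; split; first exact: cmeasurable_mul_cis.
rewrite (_ : (fun x => sqmod _) = fun x => sqmod (f x))//.
by apply/funext => x; rewrite sqmodM sqmod_cis mulr1.
Qed.

Lemma energy_mul_cis f a : energy (fun x => f x * cis (a * x)) = energy f.
Proof.
by apply: eq_Rintegral => x _; rewrite sqmodM sqmod_cis mulr1.
Qed.

(** Each coordinate is dominated by [1 + sqmod (f x)], and the constant [1] is integrable because
    the interval has finite measure. *)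
Lemma L2_cintegrable f : L2 I f -> cintegrable f.
Proof.
move=> /L2P[mf nf]; have [mr mi] := mf.
have i1 := integrable_unitD (integrable_cst_unit 1) nf.
have le1 (r s : R) : `|r| <= 1 + (r ^+ 2 + s ^+ 2).
  rewrite -[r ^+ 2]real_normK ?num_real//.
  have := sqr_ge0 (`|r| - 1); have := sqr_ge0 s; have := normr_ge0 r; nra.
split; apply: (integrable_le _ i1) => // x _; first exact: le1.
by rewrite /sqmod [X in _ + X]addrC; exact: le1.
Qed.

Lemma cintegralB f g : cintegrable f -> cintegrable g ->
  cintegral I (fun x => f x - g x) = cintegral I f - cintegral I g.
Proof.
move=> [fr fi] [gr gi]; apply/eqP; rewrite eq_complex/=.
by rewrite -!RintegralB//; apply/andP; split; apply/eqP;
  apply: eq_Rintegral => x _; case: (f x) => ? ?; case: (g x).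
Qed.

Lemma cintegralZ c f : cintegrable f ->
  cintegral I (fun x => c * f x) = c * cintegral I f.
Proof.
case: c => a b [fr fi]; apply/eqP; rewrite eq_complex/=.
rewrite -!RintegralZl// -RintegralB ?integrable_unitZ//.
rewrite -RintegralD ?integrable_unitZ//.
by apply/andP; split; apply/eqP;
  apply: eq_Rintegral => x _; case: (f x) => ? ? /=.
Qed.

Lemma fourierE f l :
  fourier I f l = cintegral I (fun x => f x * cis (- (2 * pi * l) * x)).
Proof.
rewrite /fourier; congr cintegral; apply/funext => x.
by rewrite cexp_cis mulNr.
Qed.

End square_integrable.

(** * Orthonormality of the characters and a Bessel-type inequality *)

Section bessel.
Context {R : realType}.
Implicit Types (a b : R) (j k : int) (f g : R -> R[i]).
Local Notation mu := (@lebesgue_measure R).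
Local Notation I := (`[0%R, 1%R]%classic : set R).

Lemma cis_2pi_int k : cis (2 * pi * k%:~R) = 1 :> R[i].
Proof.
have nat_case n : cis (2 * pi * n%:R) = 1 :> R[i].
  have -> : 2 * pi * n%:R = 0 + pi *+ 2 *+ n :> R.
    by rewrite add0r -mulr_natr -mulr_natl; ring.
  rewrite /cis (periodicn (@cosD2pi R)) (periodicn (@sinD2pi R)).
  by rewrite cos0 sin0.
case: k => n; first exact: nat_case.
rewrite NegzE mulrNz mulrN; move: (nat_case n.+1) => [c1 s0].
by rewrite /cis cosN sinN c1 s0 oppr0.
Qed.

Lemma Rintegral_FTC (h H : R -> R) : continuous h ->
  (forall x, is_derive x (1 : R) H (h x)) ->
  \int[mu]_(x in I) h x = H 1 - H 0.
Proof.
move=> ch dH; rewrite /Rintegral (@continuous_FTC2 _ h H)//.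
- exact: continuous_subspaceT.
- have cH : continuous H.
    by move=> x; apply: differentiable_continuous; apply/derivable1_diffP.
  split => //.
  + by apply: cvg_at_right_filter; exact: cH.
  + by apply: cvg_at_left_filter; exact: cH.
- by move=> x _; rewrite derive1E; have [] := dH x.
Qed.

(** For [k != 0], the antiderivatives of the cosine and the sine take equal values at [0] and [1],
    since [2 * pi * k] is a period. *)
Lemma cintegral_char k : cintegral I (char k) = (k == 0)%:R :> R[i].
Proof.
have [->|k0] := eqVneq k 0.
  have -> : char 0 = cst 1 :> (R -> R[i]).
    by apply/funext => x; rewrite /char mulr0z mulr0 mul0r cis0.
  by apply/eqP; rewrite eq_complex/= !Rintegral_unit_cst !eqxx.
have [c1 s0] := cis_2pi_int k.
rewrite /char; set a : R := 2 * pi * k%:~R in c1 s0 *.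
have a0 : a != 0.
  by rewrite !mulf_neq0// ?intr_eq0// gt_eqF// pi_gt0.
have dS x : is_derive x (1 : R) (fun x => a^-1 * sin (a * x)) (cos (a * x)).
  by apply: is_derive_eq; rewrite /GRing.scale/=; field.
have dC x : is_derive x (1 : R) (fun x => - a^-1 * cos (a * x)) (sin (a * x)).
  by apply: is_derive_eq; rewrite /GRing.scale/=; field.
apply/eqP; rewrite eq_complex/=; apply/andP; split; apply/eqP.
- rewrite (Rintegral_FTC _ dS) ?mulr1 ?mulr0 ?sin0 ?s0 ?mulr0 ?subrr// => x.
  by apply: continuous_comp; [exact: mulrl_continuous|exact: continuous_cos].
- rewrite (Rintegral_FTC _ dC) ?mulr1 ?mulr0 ?cos0 ?c1 ?subrr// => x.
  by apply: continuous_comp; [exact: mulrl_continuous|exact: continuous_sin].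
Qed.

Lemma fourier_charB f c j k : L2 I f ->
  fourier I (fun x => f x - c * char j x) k%:~R =
  fourier I f k%:~R - c * (k == j)%:R.
Proof.
move=> Lf; rewrite !fourierE.
have -> : (fun x => (f x - c * char j x) * cis (- (2 * pi * k%:~R) * x)) =
   (fun x => f x * cis (- (2 * pi * k%:~R) * x) - c * char (j - k) x).
  apply/funext => x; rewrite mulrBl -[c * _ * _]mulrA /char -cisD.
  congr (_ - _ * cis _).
  by rewrite intrB; ring.
have Lc m : L2 I (@char R m).
  have := L2_mul_cis (2 * pi * m%:~R) (@L2_cst R 1).
  by congr L2; apply/funext => x /=; rewrite mul1r.
rewrite cintegralB; last 2 first.
- exact/L2_cintegrable/L2_mul_cis.
- have := L2_cintegrable (L2_mul_cis (2 * pi * (j - k)%:~R) (@L2_cst R c)).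
  by [].
rewrite cintegralZ ?cintegral_char ?subr_eq0 1?eq_sym//.
exact: L2_cintegrable.
Qed.

Lemma L2_charB f c j : L2 I f -> L2 I (fun x => f x - c * char j x).
Proof. by move=> Lf; apply: L2B => //; exact/L2_mul_cis/L2_cst. Qed.

(** Rotating by the conjugate character turns the integrand into [sqmod (h x - c)], where [h] has
    integral [fourier I f k]. Expanding, integrating and completing the square in [c] gives the
    identity. *)
Lemma energy_charB f c k : L2 I f ->
  energy (fun x => f x - c * char k x) =
  energy f + sqmod (fourier I f k%:~R - c) - sqmod (fourier I f k%:~R).
Proof.
move=> Lf; set F := fourier _ _ _.
pose h x := f x * cis (- (2 * pi * k%:~R) * x).
have [ihr ihi] : cintegrable h by exact/L2_cintegrable/L2_mul_cis.
have /L2P[_ sf] := Lf.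
have E x : sqmod (f x - c * char k x) =
  sqmod (f x) + (sqmod c - ((2 * complex.Re c) * complex.Re (h x) +
                            (2 * complex.Im c) * complex.Im (h x))).
  have -> : f x - c * char k x = (h x - c) * char k x.
    by rewrite mulrBl /h /char -[f x * _ * _]mulrA -cisD mulNr addNr cis0 mulr1.
  have -> : sqmod (f x) = sqmod (h x).
    by rewrite sqmodM sqmod_cis mulr1.
  rewrite sqmodM sqmod_cis mulr1.
  by case: (h x) => u v; case: c => r s; rewrite /sqmod/=; ring.
have iB (u v : R -> R) : mu.-integrable I (EFin \o u) ->
    mu.-integrable I (EFin \o v) ->
    mu.-integrable I (EFin \o (fun x => u x - v x)).
  by move=> iu iv; exact: (integrableB _ iu iv).
rewrite /energy; under eq_Rintegral do rewrite E.
have i1 := integrable_cst_unit (sqmod c).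
have i2 := integrable_unitZ (2 * complex.Re c) ihr.
have i3 := integrable_unitZ (2 * complex.Im c) ihi.
rewrite (RintegralD _ sf (iB _ _ i1 (integrable_unitD i2 i3)))//.
rewrite (RintegralB _ i1 (integrable_unitD i2 i3))// (RintegralD _ i2 i3)//.
rewrite !RintegralZl// Rintegral_unit_cst /F fourierE -/h /cintegral.
set u := (\int[mu]_(x in I) complex.Re (h x)).
set v := (\int[mu]_(x in I) complex.Im (h x)).
by case: c {E i1 i2 i3} => r s; rewrite /sqmod/=; ring.
Qed.

(** The modes are removed one at a time: by [energy_charB], subtracting any multiple of [char k]
    lowers the energy by at most the squared [k]-th coefficient. The [c k] are therefore
    arbitrary. *)
Lemma bessel_approximation f (c : int -> R[i]) (s : seq int) :
  L2 I f -> uniq s ->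
  energy f <= \sum_(k <- s) sqmod (fourier I f k%:~R) +
              energy (fun x => f x - \sum_(k <- s) c k * char k x).
Proof.
elim: s f => [|k s IH] f Lf /=.
  move=> _; rewrite big_nil add0r.
  by under [X in _ <= energy X]eq_fun do rewrite big_nil subr0.
move=> /andP[ks us].
have := IH _ (L2_charB (c k) k Lf) us.
rewrite energy_charB// big_cons.
under [X in _ <= _ + energy X]eq_fun do rewrite -addrA -opprD.
under [X in _ -> _ <= _ + energy X]eq_fun do rewrite big_cons.
(* As [k] is not in the tail [s], orthogonality leaves the remaining coefficients of [f]
   unchanged. *)
have -> : \sum_(i <- s)
      sqmod (fourier I (fun x => f x - c k * char k x) i%:~R) =
    \sum_(i <- s) sqmod (fourier I f i%:~R).
  rewrite big_seq [RHS]big_seq; apply: eq_bigr => i si; congr sqmod.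
  rewrite fourier_charB// (_ : i == k = false) ?mulr0 ?subr0//.
  by apply/eqP => ik; rewrite -ik si in ks.
by have := sqmod_ge0 (fourier I f k%:~R - c k); lra.
Qed.

End bessel.

(** * Mean-square approximation by real trigonometric polynomials *)

Section trigonometric_density.
Context {R : realType}.
Implicit Types (a b t x : R) (u v p q : R -> R) (S : set R).
Local Notation mu := (@lebesgue_measure R).
Local Notation I := (`[0%R, 1%R]%classic : set R).

(** An algebra given by generators: closure under products makes the high powers in [bump]
    trigonometric polynomials at once. *)
Inductive trigpoly : (R -> R) -> Prop :=
| trigpoly_cst a : trigpoly (cst a)
| trigpoly_cos : trigpoly (fun x => cos (2 * pi * x))
| trigpoly_sin : trigpoly (fun x => sin (2 * pi * x))
| trigpolyD p q : trigpoly p -> trigpoly q -> trigpoly (fun x => p x + q x)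
| trigpolyM p q : trigpoly p -> trigpoly q -> trigpoly (fun x => p x * q x).

Lemma trigpolyX p n : trigpoly p -> trigpoly (fun x => p x ^+ n).
Proof.
move=> tp; elim: n => [|n IH]; first exact: (trigpoly_cst 1).
rewrite (_ : (fun _ => _) = fun x => p x * p x ^+ n); first exact: trigpolyM.
by apply/funext => x; rewrite exprS.
Qed.

Lemma measurable_trigpoly p : trigpoly p -> measurable_fun I p.
Proof.
elim=> [a|||{}p q _ mp _ mq|{}p q _ mp _ mq].
- exact: measurable_cst.
- exact: measurable_cos_lin.
- exact: measurable_sin_lin.
- exact: measurable_funD.
- exact: measurable_funM.
Qed.

(** Squared distance with extended real values, so that it can be manipulated before integrability
    is known. *)
Definition dist2 u v : \bar R := (\int[mu]_(x in I) ((u x - v x) ^+ 2)%:E)%E.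

Definition approximable u :=
  forall e : R, 0 < e -> exists2 p, trigpoly p & (dist2 u p < e%:E)%E.

Lemma measurable_sqrB u v : measurable_fun I u -> measurable_fun I v ->
  measurable_fun I (fun x => ((u x - v x) ^+ 2)%:E).
Proof.
move=> mu_ mv; apply/measurable_EFinP; apply: measurable_funX.
exact: measurable_funB.
Qed.

Lemma dist2_eq u v w : {in I, forall x, u x = v x} -> dist2 u w = dist2 v w.
Proof. by move=> uv; apply: eq_integral => x /uv ->. Qed.

Lemma eq_approximable u v : {in I, forall x, u x = v x} ->
  approximable u -> approximable v.
Proof.
by move=> uv au e /au[p tp pe]; exists p; rewrite // -(dist2_eq _ uv).
Qed.

Lemma trigpoly_approximable p : trigpoly p -> approximable p.
Proof.
move=> tp e e0; exists p => //; rewrite /dist2 integral0_eq ?lte_fin//.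
by move=> x _; rewrite subrr expr0n.
Qed.

Lemma dist2_triangle u v w : measurable_fun I u -> measurable_fun I v ->
  measurable_fun I w -> (dist2 u w <= 2%:E * dist2 u v + 2%:E * dist2 v w)%E.
Proof.
move=> mu_ mv mw.
have ge0 (f g : R -> R) x : (0 <= ((f x - g x) ^+ 2)%:E)%E.
  by rewrite lee_fin sqr_ge0.
have m1 := measurable_sqrB mu_ mv; have m2 := measurable_sqrB mv mw.
rewrite -!ge0_integralZl ?lee_fin//; [|by move=> x _; exact: ge0..].
rewrite -ge0_integralD//; last 4 first.
- by move=> x _; rewrite mule_ge0.
- exact: measurable_funeM.
- by move=> x _; rewrite mule_ge0.
- exact: measurable_funeM.
apply: ge0_le_integral => //.
- exact: measurable_sqrB.
- by apply: emeasurable_funD; exact: measurable_funeM.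
move=> x _; rewrite -!EFinM -EFinD lee_fin.
(* With [a = u x - v x] and [b = v x - w x], the bound [(a + b) ^ 2 <= 2 * a ^ 2 + 2 * b ^ 2]
   amounts to [0 <= (a - b) ^ 2]. *)
by have := sqr_ge0 (u x - v x - (v x - w x)); nra.
Qed.

Lemma approximable_closed u : measurable_fun I u ->
  (forall e : R, 0 < e -> exists v,
     [/\ measurable_fun I v, approximable v & (dist2 u v < e%:E)%E]) ->
  approximable u.
Proof.
(* Two errors, each doubled by [dist2_triangle], call for the tolerance [e / 4]. *)
move=> mu_ H e e0; have e4 : 0 < e / 4 by rewrite divr_gt0.
have [v [mv av uv]] := H _ e4; have [p tp vp] := av _ e4.
exists p => //.
apply: (le_lt_trans (dist2_triangle mu_ mv (measurable_trigpoly tp))).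
rewrite (_ : e%:E = 2%:E * (e / 4)%:E + 2%:E * (e / 4)%:E)%E; last first.
  by rewrite -!EFinM -EFinD; congr EFin; lra.
by apply: lteD; rewrite lte_pmul2l.
Qed.

Lemma approximableD u v : measurable_fun I u -> measurable_fun I v ->
  approximable u -> approximable v -> approximable (fun x => u x + v x).
Proof.
move=> mu_ mv au av e e0; have e4 : 0 < e / 4 by rewrite divr_gt0.
have [p tp up] := au _ e4; have [q tq vq] := av _ e4.
exists (fun x => p x + q x); first exact: trigpolyD.
have mp := measurable_trigpoly tp; have mq := measurable_trigpoly tq.
have E f g h : dist2 (fun x => f x + h x) (fun x => g x + h x) = dist2 f g.
  by apply: eq_integral => x _; congr EFin; congr (_ ^+ 2); lra.
(* Passing through [p + v] changes one summand at a time, so each leg is a distance already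
   controlled. *)
apply: (le_lt_trans (@dist2_triangle _ (fun x => p x + v x) _ _ _ _));
  [exact: measurable_funD..|].
rewrite E [X in (_ + _ * X < _)%E](_ : _ = dist2 v q); last first.
  by apply: eq_integral => x _; congr EFin; congr (_ ^+ 2); lra.
rewrite (_ : e%:E = 2%:E * (e / 4)%:E + 2%:E * (e / 4)%:E)%E; last first.
  by rewrite -!EFinM -EFinD; congr EFin; lra.
by apply: lteD; rewrite lte_pmul2l.
Qed.

Lemma approximableZ a u : measurable_fun I u ->
  approximable u -> approximable (fun x => a * u x).
Proof.
move=> mu_ au e e0.
(* Scaling by [a] multiplies [dist2] by [a ^ 2]; the added [1] keeps the denominator positive when
   [a = 0]. *)
have k0 : 0 < e / (a ^+ 2 + 1) by rewrite divr_gt0// ltr_wpDl ?sqr_ge0.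
have [p tp up] := au _ k0; exists (fun x => a * p x).
  exact: trigpolyM (trigpoly_cst a) tp.
rewrite (_ : dist2 _ _ = (a ^+ 2)%:E * dist2 u p)%E; last first.
  rewrite -ge0_integralZl//.
  - by apply: eq_integral => x _; rewrite -EFinM; congr EFin; ring.
  - exact: measurable_sqrB (measurable_trigpoly tp).
  - by move=> x _; rewrite lee_fin sqr_ge0.
  - by rewrite lee_fin sqr_ge0.
apply: (@le_lt_trans _ _ ((a ^+ 2)%:E * (e / (a ^+ 2 + 1))%:E)%E).
  by apply: lee_wpmul2l; [rewrite lee_fin sqr_ge0|exact: ltW].
rewrite -EFinM lte_fin mulrA ltr_pdivrMr ?ltr_wpDl ?sqr_ge0//.
by rewrite mulrC ltr_pM2l// ltrDl.
Qed.

(** Dominated convergence applied to [(u - un n) ^ 2] makes [dist2 u (un n)] tend to [0], and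
    [approximable_closed] concludes. *)
Lemma approximable_limit (un : nat -> R -> R) u (g : R -> R) :
  (forall n, measurable_fun I (un n)) -> measurable_fun I u ->
  (forall n, approximable (un n)) ->
  {ae mu, forall x, I x -> un n x @[n --> \oo] --> u x} ->
  mu.-integrable I (EFin \o g) ->
  (forall n x, I x -> (u x - un n x) ^+ 2 <= g x) ->
  approximable u.
Proof.
move=> mun mu_ aun cun ig lg; apply: approximable_closed => // e e0.
have [|||||_ _ cD] := @dominated_convergence _ _ _ mu I _
  (fun n x => ((u x - un n x) ^+ 2)%:E) (cst 0%E) (EFin \o g) _ _ _ ig.
- exact: measurable_itv.
- by move=> n; exact: measurable_sqrB.
- exact: measurable_cst.
- have aeF := ae_filter_ringOfSetsType mu.
  apply: filterS cun => x cx Ix; apply: cvg_EFin; first exact: nearW.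
  have d0 : u x - un n x @[n --> \oo] --> u x - u x.
    by apply: cvgB; [exact: cvg_cst|exact: cx].
  by rewrite -(mulr0 (0 : R)) -(subrr (u x)); exact: (cvgM d0 d0).
- apply: aeW => x n Ix; rewrite /= ger0_norm ?sqr_ge0// lee_fin; exact: lg.
rewrite integral0_eq// in cD.
have e0' : (0 < e%:E)%E by rewrite lte_fin.
have [N _ /(_ N (leqnn N))/= Ne] := cD _ (open_ereal_lt' e0').
by exists (un N).
Qed.

End trigonometric_density.

(** * Approximation of indicators of rays by bump polynomials *)

Section indicators.
Context {R : realType}.
Implicit Types (p t x : R) (n : nat).
Local Notation mu := (@lebesgue_measure R).
Local Notation I := (`[0%R, 1%R]%classic : set R).

(** At [t = p ^ n] and [K = 2 ^ n] this bounds [bump p n] below by [1 - (2 * p) ^ n]. *)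
Lemma bernoulli_ge t K : 0 <= t <= 1 -> 1 - K%:R * t <= (1 - t) ^+ K.
Proof.
move=> /andP[t0 t1]; elim: K => [|K IH]; first by rewrite mul0r subr0 expr0.
have K0 : 0 <= K%:R :> R by [].
rewrite exprS -natr1 (le_trans _ (ler_wpM2l _ IH)) ?subr_ge0//.
by have := mulr_ge0 K0 (sqr_ge0 t); nra.
Qed.

(** The induction rests on [(1 - t) * (1 + (K + 1) * t) <= 1 + K * t]. At [t = p ^ n] and
    [K = 2 ^ n] it yields [bump p n * (2 * p) ^ n <= 1], which forces decay when [2 * p > 1]. *)
Lemma bernoulli_le t K : 0 <= t <= 1 -> (1 - t) ^+ K * (1 + K%:R * t) <= 1.
Proof.
move=> /andP[t0 t1]; elim: K => [|K IH]; first by rewrite mul0r addr0 mulr1.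
have K0 : 0 <= K%:R :> R by [].
apply: le_trans IH; rewrite exprSr -mulrA ler_wpM2l ?exprn_ge0 ?subr_ge0//.
by rewrite -natr1; have := mulr_ge0 K0 (sqr_ge0 t); nra.
Qed.

(* Brosowski and Deutsch's polynomials, from their proof of the
   Stone-Weierstrass theorem. *)
Definition bump (p : R) n : R := (1 - p ^+ n) ^+ (2 ^ n).

Lemma bump_itv p n : 0 <= p <= 1 -> 0 <= bump p n <= 1.
Proof.
move=> /andP[p0 p1]; have pn : 0 <= p ^+ n <= 1.
  by rewrite exprn_ge0//= exprn_ile1.
case/andP: pn => pn0 pn1.
by rewrite /bump exprn_ge0 ?subr_ge0//= exprn_ile1 ?subr_ge0// lerBlDr lerDl.
Qed.

Lemma bump_cvg1 p : 0 <= p < 1 / 2 -> bump p n @[n --> \oo] --> (1 : R).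
Proof.
move=> /andP[p0 p2]; have p1 : p <= 1 by lra.
have c : 1 - (2 * p) ^+ n @[n --> \oo] --> (1 - 0 : R).
  apply: cvgB; first exact: cvg_cst.
  by apply: cvg_expr; rewrite ger0_norm; lra.
rewrite subr0 in c; apply: (squeeze_cvgr _ c (cvg_cst _)).
apply: nearW => n; have /andP[_ ->] : 0 <= bump p n <= 1.
  by apply: bump_itv; rewrite p0.
rewrite andbT exprMn -natrX; apply: bernoulli_ge.
by rewrite exprn_ge0//= exprn_ile1.
Qed.

Lemma bump_cvg0 p : 1 / 2 < p <= 1 -> bump p n @[n --> \oo] --> (0 : R).
Proof.
move=> /andP[p2 p1]; have p0 : 0 < p by lra.
have c : (2 * p)^-1 ^+ n @[n --> \oo] --> (0 : R).
  apply: cvg_expr; rewrite ger0_norm; last by rewrite invr_ge0; lra.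
  by rewrite invf_lt1; lra.
apply: (squeeze_cvgr _ (cvg_cst _) c).
apply: nearW => n; have /andP[b0 _] : 0 <= bump p n <= 1.
  by apply: bump_itv; rewrite (ltW p0).
rewrite b0/= exprVn -div1r ler_pdivlMr ?exprn_gt0 ?mulr_gt0//.
have pn : 0 <= p ^+ n <= 1.
  by rewrite exprn_ge0 ?(ltW p0)//= exprn_ile1 ?(ltW p0).
have := bernoulli_le (2 ^ n) pn; rewrite -/(bump p n) natrX -exprMn.
by rewrite mulrDr mulr1; apply: le_trans; rewrite lerDr.
Qed.

(** A trigonometric polynomial of degree one in [t], with the cosine centred at [x / 2] so that the
    value [1 / 2] is taken at [t = 0] and [t = x]. *)
Definition arc x t : R :=
  1 / 2 - (cos (2 * pi * t - pi * x) - cos (pi * x)) / 4.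

(** The product form shows on which side of [1 / 2] the value lies: for [t] in []0, 1[] the first
    sine is positive, and the second has the sign of [x - t]. *)
Lemma arcE x t : arc x t = 1 / 2 - sin (pi * t) * sin (pi * (x - t)) / 2.
Proof.
rewrite /arc; congr (_ - _).
have -> : 2 * pi * t - pi * x = pi * t - pi * (x - t) by ring.
have -> : pi * x = pi * t + pi * (x - t) by ring.
by rewrite cosB cosD; field.
Qed.

Lemma arc_itv x t : 0 <= arc x t <= 1.
Proof.
rewrite /arc; have := cos_le1 (2 * pi * t - pi * x).
have := cos_geN1 (2 * pi * t - pi * x); have := cos_le1 (pi * x).
by have := cos_geN1 (pi * x); lra.
Qed.

Lemma sin_pi_gt0 t : 0 < t < 1 -> 0 < sin (pi * t).
Proof.
move=> /andP[t0 t1]; apply: sin_gt0_pi.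
by rewrite mulr_gt0 ?pi_gt0//= gtr_pMr ?pi_gt0.
Qed.

Lemma arc_lt x t : 0 < t < x -> x <= 1 -> arc x t < 1 / 2.
Proof.
move=> /andP[t0 tx] x1; rewrite arcE gtrBl divr_gt0// mulr_gt0//.
  by apply: sin_pi_gt0; lra.
by apply: sin_pi_gt0; lra.
Qed.

Lemma arc_gt x t : 0 < x < t -> t < 1 -> 1 / 2 < arc x t.
Proof.
move=> /andP[x0 xt] t1; rewrite arcE -(opprB t x) mulrN sinN mulrN mulNr opprK.
rewrite ltrDl divr_gt0// mulr_gt0//.
  by apply: sin_pi_gt0; lra.
by apply: sin_pi_gt0; lra.
Qed.

Lemma trigpoly_bump_arc x n : trigpoly (fun t => bump (arc x t) n).
Proof.
have tarc : trigpoly (arc x).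
  rewrite (_ : arc x = fun t => (1 / 2 + cos (pi * x) / 4) +
    ((- cos (pi * x) / 4) * cos (2 * pi * t) +
     (- sin (pi * x) / 4) * sin (2 * pi * t))).
    apply: trigpolyD (trigpoly_cst _) _; apply: trigpolyD.
      exact: trigpolyM (trigpoly_cst _) trigpoly_cos.
    exact: trigpolyM (trigpoly_cst _) trigpoly_sin.
  by apply/funext => t; rewrite /arc cosB; field.
apply: trigpolyX.
rewrite (_ : (fun _ => _) = fun t => 1 + (-1) * arc x t ^+ n).
  apply: trigpolyD (trigpoly_cst _) _; apply: trigpolyM (trigpoly_cst _) _.
  exact: trigpolyX.
by apply/funext => t; rewrite mulN1r.
Qed.

Lemma approximable_ray x : approximable (\1_(`]-oo, x[%classic) : R -> R).
Proof.
(* On the unit interval the indicator is constant unless [0 < x <= 1]. *)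
have [x0|x0] := leP x 0.
  apply: (@eq_approximable _ (cst 0)).
    move=> t; rewrite inE/= in_itv/= => /andP[t0 _].
    rewrite indicE (_ : _ \in _ = false)//; apply/negbTE; rewrite notin_setE/=.
    by rewrite in_itv/=; lra.
  exact/trigpoly_approximable/trigpoly_cst.
have [x1|x1] := ltP 1 x.
  apply: (@eq_approximable _ (cst 1)).
    move=> t; rewrite inE/= in_itv/= => /andP[_ t1].
    by rewrite indicE mem_set//= in_itv/=; lra.
  exact/trigpoly_approximable/trigpoly_cst.
apply: (@approximable_limit _ (fun n t => bump (arc x t) n) _ (cst 1)).
- by move=> n; apply: measurable_trigpoly; exact: trigpoly_bump_arc.
- by apply: measurable_indic; exact: measurable_itv.
- by move=> n; exact/trigpoly_approximable/trigpoly_bump_arc.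
(* At [0], [x] and [1] the value of [arc x] is exactly [1 / 2], where [bump] tends to [1 / e]; these
   points form a null set. *)
- have cN : countable ([set 0; x; 1] : set R).
    by apply: finite_set_countable; rewrite !finite_setU; do !split.
  exists [set 0; x; 1]; split.
  + by apply: countable_measurable => // t; exact: measurable_set1.
  + exact: countable_lebesgue_measure0.
  move=> t /=; apply: contra_notP => nt; rewrite in_itv/= => /andP[t0 t1].
  have {}t0 : 0 < t.
    by rewrite lt_def t0 andbT; apply/eqP => t0'; apply: nt; left; left.
  have {}t1 : t < 1.
    by rewrite lt_def t1 andbT; apply/eqP => t1'; apply: nt; right.
  rewrite indicE; have [tx|xt|tx] := ltgtP t x.
  + rewrite mem_set/= ?in_itv//=; apply: bump_cvg1.
    by rewrite arc_lt ?t0// andbT; case/andP: (arc_itv x t).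
  + rewrite memNset/= ?in_itv/= ?ltNge ?(ltW xt)//; apply: bump_cvg0.
    by rewrite arc_gt ?x0//=; case/andP: (arc_itv x t).
  + by exfalso; apply: nt; left; right.
- exact: integrable_cst_unit.
- move=> n t _ /=; have /andP[] := bump_itv n (arc_itv x t).
  by rewrite indicE; case: (_ \in _) => /=; nra.
Qed.

End indicators.

(** * From rays to measurable sets, then to square-integrable functions *)

Section density.
Context {R : realType}.
Implicit Types (u v p q : R -> R) (S : set R).
Import HBSimple HBNNSimple.
Local Notation mu := (@lebesgue_measure R).
Local Notation I := (`[0%R, 1%R]%classic : set R).

Lemma approximable_sum (T : Type) (s : seq T) (F : T -> R -> R) :
  (forall i, measurable_fun I (F i)) -> (forall i, approximable (F i)) ->
  approximable (fun x => \sum_(i <- s) F i x).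
Proof.
move=> mF aF; elim: s => [|i s IH].
  under eq_fun do rewrite big_nil.
  exact/trigpoly_approximable/trigpoly_cst.
under eq_fun do rewrite big_cons.
by apply: approximableD => //; exact: measurable_sum.
Qed.

(** Open rays are stable under intersection and generate the Borel sets, while the sets with
    approximable indicator form a Dynkin system. *)
Lemma approximable_indic S : measurable S -> approximable (\1_S : R -> R).
Proof.
move=> mS.
have mI (A : set R) : measurable A -> measurable_fun I (\1_A : R -> R).
  by move=> mA; exact: measurable_indic.
apply: (@dynkin_induction _ _ (@RGenInftyO.G R)
  (fun S => approximable (\1_S : R -> R))) => //.
- exact: RGenInftyO.measurableE.
- move=> _ _ [x ->] [y ->]; exists (Num.min x y); apply/seteqP; split => z /=;
    by rewrite !in_itv/= lt_min => /andP.
- by rewrite indicT; exact/trigpoly_approximable/trigpoly_cst.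
- by move=> _ [x ->]; exact: approximable_ray.
- move=> A mA aA.
  apply: (@eq_approximable _ (fun x => cst 1 x + (-1) * \1_A x)).
    move=> x _; rewrite !indicE in_setC; case: (_ \in _) => /=; lra.
  apply: approximableD => //.
  + by apply: measurable_funM => //; exact: mI.
  + exact/trigpoly_approximable/trigpoly_cst.
  + by apply: approximableZ => //; exact: mI.
- move=> F mF tF aF.
  have mFU : measurable (\bigcup_k F k) by exact: bigcup_measurable.
  pose un n x : R := \sum_(k <- iota 0 n) \1_(F k) x.
  (* Disjointness makes each partial sum an indicator again, so its squared distance to the limit is
     at most [1] and the constant [1] dominates. *)
  have un_indic n x : un n x = \1_(\bigcup_(k in `I_n) F k) x.
    rewrite /un -[n in iota _ n]subn0 -/(index_iota 0 n).
    rewrite indicE; case: (boolP (x \in _)) => [|].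
      rewrite inE => -[k /= kn Fkx].
      rewrite (bigD1_seq k) ?iota_uniq//=; last first.
        by rewrite mem_index_iota.
      rewrite indicE mem_set// big1 ?addr0// => j jk.
      rewrite indicE memNset// => Fjx.
      by move/eqP: jk; apply; apply: (tF j k) => //; exists x.
    move=> nx; rewrite big_seq big1// => k.
    rewrite mem_index_iota => /andP[_ kn].
    rewrite indicE memNset// => Fkx; move: nx; rewrite notin_setE; apply.
    by exists k.
  apply: (@approximable_limit _ un _ (cst 1)).
  + by move=> n; apply: measurable_sum => k; exact: mI.
  + exact: mI.
  + by move=> n; apply: approximable_sum => k //; exact: mI.
  + apply: aeW => x _; have [[k _ Fkx]|nF] := pselect ((\bigcup_k F k) x).
      rewrite indicE mem_set; last by exists k.
      apply: cvg_near_cst; exists k.+1 => // n /= kn.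
      by rewrite un_indic indicE mem_set//; exists k.
    rewrite indicE memNset//; apply: cvg_near_cst; apply: nearW => n.
    by rewrite un_indic indicE memNset// => -[k _ Fkx]; apply: nF; exists k.
  + exact: integrable_cst_unit.
  + move=> n x _ /=; rewrite un_indic !indicE.
    by case: (_ \in _); case: (_ \in _) => /=; nra.
- have G_gen : measurable = <<s @RGenInftyO.G R >> := @RGenInftyO.measurableE R.
  by rewrite -G_gen.
Qed.

(** Simple functions [g n] increase to [u] with [0 <= g n <= u], so [(u - g n) ^ 2] is dominated by
    the integrable [u ^ 2]. *)
Lemma approximable_ge0 u : measurable_fun I u -> (forall x, 0 <= u x) ->
  mu.-integrable I (EFin \o (fun x => u x ^+ 2)) -> approximable u.
Proof.
move=> mu_ u0 iu.
have mI : measurable I by exact: measurable_itv.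
have mEu : measurable_fun I (EFin \o u) by exact/measurable_EFinP.
pose g := nnsfun_approx mI mEu.
have gm n : measurable_fun I (g n) by exact: measurable_funTS.
have gu x : I x -> g n x @[n --> \oo] --> u x.
  move=> Ix; have := @cvg_nnsfun_approx _ _ _ _ mI _ mEu _ x Ix.
  by move=> /(_ (fun x _ => u0 x))/fine_cvgP[].
apply: (@approximable_limit _ g _ (fun x => u x ^+ 2)) => //.
(* A simple function is the finite combination of the indicators of its level sets. *)
- move=> n; apply: (@eq_approximable _ (fun x =>
    \sum_(y <- finmap.enum_fset (fset_set (range (g n))))
       y * \1_(g n @^-1` [set y]) x)).
    by move=> x _; rewrite [RHS]fimfunE fsbig_finite.
  have mS y : measurable (g n @^-1` [set y]) by exact: measurable_sfunP.
  apply: approximable_sum => y.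
  + by apply: measurable_funM => //; exact: measurable_indic.
  + apply: approximableZ; first exact: measurable_indic.
    exact: approximable_indic.
- exact: aeW.
- move=> n x Ix; have g0 : 0 <= g n x by [].
  have : g n x <= u x.
    rewrite -lee_fin /g nnsfun_approxE.
    by apply: (@le_approx _ _ _ I (EFin \o u)) => // y _; rewrite lee_fin.
  nra.
Qed.

Lemma approximable_L2 u : measurable_fun I u ->
  mu.-integrable I (EFin \o (fun x => u x ^+ 2)) -> approximable u.
Proof.
move=> mu_ iu.
have mx0 v : measurable_fun I v -> measurable_fun I (fun x => Num.max (v x) 0).
  by move=> mv; exact: measurable_maxr.
(* Stated for any [v] with the same square as [u], in order to serve both the positive part
   ([v = u]) and the negative part ([v = - u]). *)
have imax v : measurable_fun I v -> (forall x, v x ^+ 2 = u x ^+ 2) ->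
    approximable (fun x => Num.max (v x) 0).
  move=> mv vu; apply: approximable_ge0.
  - exact: mx0.
  - by move=> x; rewrite le_max lexx orbT.
  - apply: (integrable_le _ iu).
      by apply: measurable_funX; exact: mx0.
    move=> x _; rewrite ger0_norm ?sqr_ge0// -vu.
    by case: (leP (v x) 0) => v0; have := sqr_ge0 (v x); nra.
have mN : measurable_fun I (fun x => - u x) by exact: measurable_funN.
apply: (@eq_approximable _
  (fun x => Num.max (u x) 0 + (-1) * Num.max (- u x) 0)).
  by move=> x _; case: (leP (u x) 0); case: (leP (- u x) 0); lra.
apply: approximableD.
- exact: mx0.
- by apply: measurable_funM => //; exact: mx0.
- exact: imax.
- by apply: approximableZ; [exact: mx0|apply: imax => // x; rewrite sqrrN].
Qed.

End density.

(** * Parseval's inequality and its version on the lattice of step [1 / N] *)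

Section parseval.
Context {R : realType}.
Implicit Types (f F G : R -> R[i]) (p q : R -> R) (l : R).
Local Notation mu := (@lebesgue_measure R).
Local Notation I := (`[0%R, 1%R]%classic : set R).

(* Laurent polynomials in [char 1], with common denominator [char N]. *)
Definition laurent F := exists (N : nat) (P : {poly R[i]}),
  forall x, F x = char (- N%:Z) x * P.[char 1 x].

Lemma laurent_cst (c : R[i]) : laurent (cst c).
Proof.
exists 0%N, c%:P => x; rewrite hornerC /char oppr0 mulr0z mulr0 mul0r.
by rewrite cis0 mul1r.
Qed.

Lemma charNn_mul m n x :
  char (- (m + n)%N%:Z) x * char n%:Z x = char (- m%:Z) x :> R[i].
Proof. by rewrite -charD PoszD opprD addrNK. Qed.

Lemma laurentD F G : laurent F -> laurent G -> laurent (fun x => F x + G x).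
Proof.
move=> [M [P FE]] [N [Q GE]]; exists (M + N)%N, ('X^N * P + 'X^M * Q) => x.
rewrite FE GE !hornerE !charX mulrDr !mulrA charNn_mul.
by rewrite addnC charNn_mul.
Qed.

Lemma laurentM F G : laurent F -> laurent G -> laurent (fun x => F x * G x).
Proof.
move=> [M [P FE]] [N [Q GE]]; exists (M + N)%N, (P * Q) => x.
by rewrite FE GE hornerM PoszD opprD charD mulrACA.
Qed.

Lemma laurent_char1 : laurent (char 1).
Proof.
exists 0%N, 'X => x.
by rewrite hornerX /char oppr0 mulr0z mulr0 mul0r cis0 mul1r.
Qed.

Lemma laurent_charN1 : laurent (char (- 1)).
Proof. by exists 1%N, 1 => x; rewrite hornerE mulr1. Qed.

Lemma laurent_trigpoly p : trigpoly p -> laurent (fun x => (p x)%:C%C).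
Proof.
have charE (k : int) x : char k x =
    (cos (2 * pi * k%:~R * x) +i* sin (2 * pi * k%:~R * x))%C :> R[i] by [].
elim=> [a|||{}p q _ lp _ lq|{}p q _ lp _ lq].
- exact: (laurent_cst a%:C%C).
- have -> : (fun x : R => (cos (2 * pi * x))%:C%C) =
    fun x => (1 / 2)%:C%C * (char 1 x + char (- 1) x).
    apply/funext => x; rewrite !charE mulrN1z mulrN mulr1 mulNr cosN sinN.
    by apply/eqP; rewrite eq_complex/=; apply/andP; split; apply/eqP; field.
  exact: laurentM (laurent_cst _) (laurentD laurent_char1 laurent_charN1).
- have -> : (fun x : R => (sin (2 * pi * x))%:C%C) =
    (* Euler's formula for the sine: the leading constant is [1 / (2 * i)]. *)
    fun x => (0 +i* (- (1 / 2)))%C * (char 1 x + (-1)%:C%C * char (- 1) x).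
    apply/funext => x; rewrite !charE mulrN1z mulrN mulr1 mulNr cosN sinN.
    by apply/eqP; rewrite eq_complex/=; apply/andP; split; apply/eqP; field.
  apply: laurentM (laurent_cst _) (laurentD laurent_char1 _).
  exact: laurentM (laurent_cst _) laurent_charN1.
- rewrite (_ : (fun x => _) = fun x => (p x)%:C%C + (q x)%:C%C).
    exact: laurentD.
  by apply/funext => x; rewrite rmorphD.
- rewrite (_ : (fun x => _) = fun x => (p x)%:C%C * (q x)%:C%C).
    exact: laurentM.
  by apply/funext => x; rewrite rmorphM.
Qed.

Lemma laurent_spectrum F : laurent F -> exists (s : seq int) (c : int -> R[i]),
  uniq s /\ forall x, F x = \sum_(k <- s) c k * char k x.
Proof.
move=> [N [P FE]]; exists [seq i%:Z - N%:Z | i <- iota 0 (size P)].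
(* [absz] only makes the index a natural number: at the listed frequencies [k = i - N] it returns
   [i]. *)
exists (fun k => P`_(absz (k + N%:Z))); split.
  by rewrite map_inj_uniq ?iota_uniq// => i j /addIr[].
move=> x; rewrite FE horner_coef big_distrr/= big_map.
rewrite -[in iota _ _](subn0 (size P)) -/(index_iota 0 (size P)) big_mkord.
apply: eq_bigr => i _; rewrite subrK absz_nat charX charD; ring.
Qed.

(** The real and imaginary parts are approximated separately within [e / 2]; for real [p] and [q]
    the two squared distances add up exactly. *)
Lemma laurent_dense f (e : R) : L2 I f -> 0 < e ->
  exists2 F, laurent F & energy (fun x => f x - F x) < e.
Proof.
move=> /L2P[mf sf] e0; have [mr mi] := mf.
have e2 : 0 < e / 2 by rewrite divr_gt0.
have [||p tp pe] := @approximable_L2 _ (fun x => complex.Re (f x)) _ _ _ e2.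
- exact: mr.
- apply: (integrable_le _ sf); first exact: measurable_funX.
  by move=> x _; rewrite ger0_norm ?sqr_ge0// lerDl sqr_ge0.
have [||q tq qe] := @approximable_L2 _ (fun x => complex.Im (f x)) _ _ _ e2.
- exact: mi.
- apply: (integrable_le _ sf); first exact: measurable_funX.
  by move=> x _; rewrite ger0_norm ?sqr_ge0// lerDr sqr_ge0.
exists (fun x => (p x)%:C%C + 'i%C * (q x)%:C%C).
  apply: laurentD; first exact: laurent_trigpoly.
  exact: laurentM (laurent_cst _) (laurent_trigpoly tq).
have mp := measurable_trigpoly tp; have mq := measurable_trigpoly tq.
have D : (\int[mu]_(x in I)
    (sqmod (f x - ((p x)%:C%C + 'i%C * (q x)%:C%C)))%:E =
  dist2 (fun x => complex.Re (f x)) p + dist2 (fun x => complex.Im (f x)) q)%E.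
  rewrite -ge0_integralD//.
  - apply: eq_integral => x _; rewrite -EFinD; congr EFin.
    by case: (f x) => u v; rewrite /sqmod/=; ring.
  - by move=> x _; rewrite lee_fin sqr_ge0.
  - exact: measurable_sqrB.
  - by move=> x _; rewrite lee_fin sqr_ge0.
  - exact: measurable_sqrB.
have lt_e : (dist2 (fun x => complex.Re (f x)) p +
             dist2 (fun x => complex.Im (f x)) q < e%:E)%E.
  by rewrite [e]splitr EFinD; exact: lteD.
rewrite /energy /Rintegral D -lte_fin fineK// ge0_fin_numE.
- exact: lt_trans lt_e (ltry _).
- by apply: adde_ge0; apply: integral_ge0 => x _; rewrite lee_fin sqr_ge0.
Qed.

(** If [F] has frequencies [s] and lies within [e] of [f], then [bessel_approximation] bounds the
    energy by a finite partial sum over [s] plus [e]. *)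
Lemma parseval_le f : L2 I f ->
  (sq_norm2 I f <=
     \esum_(k in [set: int]) (sqmod (fourier I f k%:~R))%:E)%E.
Proof.
move=> Lf; apply/lee_addgt0Pr => e e0.
have [F lF Fe] := laurent_dense Lf e0.
have [s [c [us FE]]] := laurent_spectrum lF.
rewrite sq_norm2_energy//.
have B := bessel_approximation c Lf us.
have E : energy (fun x => f x - \sum_(k <- s) c k * char k x) < e.
  by under eq_fun do rewrite -FE.
apply: (@le_trans _ _ ((\sum_(k <- s) sqmod (fourier I f k%:~R))%:E + e%:E)%E).
  by rewrite -EFinD lee_fin (le_trans B)// lerD2l ltW.
rewrite leeD2r//; apply: esum_ge; exists [set` s].
  by split; [exact: finite_seq|].
rewrite fsbig_finite//= sumEFin lee_fin.
rewrite (perm_big (finmap.enum_fset (fset_set [set` s])))//=.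
rewrite uniq_perm ?finmap.fset_uniq// => k.
by rewrite in_fset_set; [ apply/idP/idP; rewrite inE|exact: finite_seq].
Qed.

(** Sampling on a shifted copy of the integers is absorbed into a modulation of [f], which preserves
    the norm. *)
Lemma fourier_shift f l (k : int) :
  fourier I f (k%:~R + l) =
  fourier I (fun x => f x * cis (- (2 * pi * l) * x)) k%:~R.
Proof.
rewrite !fourierE; congr cintegral; apply/funext => x.
by rewrite -[f x * _ * _]mulrA -cisD; congr (_ * cis _); ring.
Qed.

Lemma fourier_lattice_le f (N : nat) : (0 < N)%N -> L2 I f ->
  (N%:R%:E * sq_norm2 I f <= \esum_(k in [set: int])
    (sqmod (fourier I f (k%:~R / N%:R)))%:E)%E.
Proof.
move=> N0 Lf.
have NR0 : N%:R != 0 :> R by rewrite pnatr_eq0 -lt0n.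
(* Euclidean division by [N]: the remainder [r < N] and the quotient [j] encode the frequency
   [j + r / N]. *)
pose e (z : nat * int) : int := z.2 * N%:Z + z.1%:Z.
have be : set_bij (`I_N `*`` (fun=> [set: int])) [set: int] e.
  split => //.
  - move=> [r j] [r' j']; rewrite !inE/= => -[/= rN _] [/= r'N _] E.
    have Er : r%:Z = r'%:Z.
      have : modz (e (r, j)) N%:Z = modz (e (r', j')) N%:Z by rewrite E.
      by rewrite /e/= !modzMDl !modz_nat !modn_small// => -[].
    move: E; rewrite /e/= Er => /addIr /mulIf -> //; first by case: Er => ->.
    by rewrite -lt0n in N0 *; lia.
  - move=> k _; exists (absz (modz k N%:Z), divz k N%:Z).
      have N0z : 0 < N%:Z by lia.
      have := ltz_pmod k N0z; have := modz_ge0 k (lt0r_neq0 N0z).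
      by split => //=; lia.
    by rewrite /e/= gez0_abs ?modz_ge0 -?divz_eq//; lia.
rewrite (@reindex_esum R _ _ _ _ _
  (fun k : int => (sqmod (fourier I f (k%:~R / N%:R)))%:E) be).
rewrite -(@esum_esum _ _ _ `I_N (fun=> [set: int]) (fun r j =>
  (sqmod (fourier I f ((e (r, j))%:~R / N%:R)))%:E)); last first.
  by move=> r j _ _; rewrite lee_fin sqmod_ge0.
(* It suffices that each of the [N] residue classes contributes at least one full squared norm. *)
apply: (@le_trans _ _ (\esum_(r in `I_N) sq_norm2 I f)%E).
  rewrite esum_fset//; last first.
    by move=> r _; apply: integral_ge0 => x _; rewrite lee_fin sqr_ge0.
  rewrite sq_norm2_energy//.
  rewrite -fsbig_ord/= sumEFin sumr_const card_ord -EFinM lee_fin.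
  by rewrite mulr_natl.
apply: le_esum => r _.
have L := L2_mul_cis (- (2 * pi * (r%:R / N%:R))) Lf.
rewrite (_ : sq_norm2 I f = sq_norm2 I
   (fun x => f x * cis (- (2 * pi * (r%:R / N%:R)) * x))); last first.
  by rewrite !sq_norm2_energy// energy_mul_cis.
apply: (le_trans (parseval_le L)); apply: le_esum => j _.
rewrite -fourier_shift (_ : (e (r, j))%:~R / N%:R = j%:~R + r%:R / N%:R :> R)//.
by rewrite /e/= intrD intrM mulrDl mulfK.
Qed.

End parseval.

(** * Constant gaps, the limit, and the conclusion *)

Lemma infinite_int : infinite_set [set: int].
Proof.
move=> fZ; apply: infinite_nat.
rewrite (_ : [set: nat] = Posz @^-1` [set: int]); last by apply/seteqP; split.
by apply: finite_preimage => // i j _ _ [].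
Qed.

(** A threshold above [d] exceeds every gap, hence infinitely many; one at most [d] exceeds none.
    Since the comparison is strict, [d] itself is not admissible and the infimum is approached
    through [d + e]. *)
Lemma gmin_cst_gap {R : realType} (lam : int -> R) (d : R) :
  0 <= d -> (forall k, gap lam k = d) -> gmin lam = d%:E.
Proof.
move=> d0 gapE; apply/eqP; rewrite eq_le; apply/andP; split.
  apply/lee_addgt0Pr => e e0; rewrite -EFinD; apply: ereal_inf_lbound.
  exists (d + e) => //; split; first by rewrite addr_ge0// ltW.
  rewrite (_ : [set k | _] = setT); first exact: infinite_int.
  by apply/seteqP; split => // k _ /=; rewrite gapE ltrDl.
apply: le_ereal_inf_tmp => _ [c [c0 infc] <-]; rewrite lee_fin leNgt.
apply/negP => cd; apply: infc.
rewrite (_ : [set k | _] = set0)//.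
by apply/seteqP; split => // k /=; rewrite gapE ltNge (ltW cd).
Qed.

(** The quotient is squeezed between [1 - A^-1] and [1]. *)
Lemma cvg_div_truncnS {R : realType} :
  A / (Num.truncn A).+1%:R @[A --> +oo] --> (1 : R).
Proof.
have c : (1 - A^-1 : R) @[A --> +oo] --> (1 - 0 : R).
  by apply: cvgB; [exact: cvg_cst|
    by apply/gtr0_cvgV0; [exact: nbhs_pinfty_gt|exact: cvg_id]].
rewrite subr0 in c; apply: (squeeze_cvgr _ c (cvg_cst _)).
near=> A.
have A0 : 0 < A by near: A; exact: nbhs_pinfty_gt.
have N0 : 0 < (Num.truncn A).+1%:R :> R by rewrite ltr0n.
have NA : A < (Num.truncn A).+1%:R by exact: truncnS_gt.
have NA1 : (Num.truncn A).+1%:R <= A + 1.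
  by rewrite -natr1 lerD2r truncn_le ltW.
rewrite [X in _ && X]ler_pdivrMr// mul1r (ltW NA) andbT.
have le_inv : (Num.truncn A).+1%:R^-1 <= A^-1 :> R by rewrite lef_pV2// ltW.
(* Writing [N] for the denominator, [N <= A + 1] gives [1 <= A / N + 1 / N], and [1 / N <= 1 / A]
   gives the lower bound. *)
have : 0 <= (A + 1 - (Num.truncn A).+1%:R) / (Num.truncn A).+1%:R :> R.
  by rewrite divr_ge0 ?subr_ge0// ltW.
rewrite mulrBl mulrDl mul1r divff ?gt_eqF// => Hd.
by rewrite lerBlDr (le_trans _ (lerD (lexx _) le_inv))// -subr_ge0.
Unshelve. all: by end_near. Qed.

Theorem proposition2p1 (R : realType) :
  exists (Lam : R -> set R) (lam : R -> int -> R),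
    [/\ forall A : R, 0 < A -> increasing_enum (lam A) (Lam A),
        forall A : R, 0 < A -> forall f : R -> R[i], L2 `[0, 1]%classic f ->
          (A%:E * sq_norm2 `[0%R, 1%R]%classic f <=
             \esum_(l in Lam A)
               (cmod (fourier `[0%R, 1%R]%classic f l) ^+ 2)%:E)%E
      & (A%:E * gmin (lam A))%E @[A --> +oo] --> (1%:E : \bar R)].
Proof.
(* The successor makes [N A] exceed [A] and keeps it positive even when the truncation is [0]. *)
pose N (A : R) := (Num.truncn A).+1.
pose lam (A : R) (k : int) : R := k%:~R / (N A)%:R.
have N0 A : 0 < (N A)%:R :> R by rewrite ltr0n.
have lam_incr A (m n : int) : m < n -> lam A m < lam A n.
  by move=> mn; rewrite /lam ltr_pM2r ?invr_gt0// ltr_int.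
exists (fun A => range (lam A)), lam; split.
- by move=> A _; split => // m n; exact: lam_incr.
- move=> A A0 f Lf.
  (* Since no frequency repeats, the sum over the set [range (lam A)] can be indexed by the
     integers. *)
  have inj : set_inj [set: int] (lam A).
    move=> j k _ _ /mulIf jk; apply/eqP.
    by rewrite -(eqr_int R) jk// gt_eqF ?invr_gt0.
  rewrite esum_image//.
  under eq_esum do rewrite cmod_sqr.
  apply: le_trans (fourier_lattice_le (ltn0Sn _) Lf).
  rewrite lee_wpmul2r//.
    by apply: integral_ge0 => x _; rewrite lee_fin sqr_ge0.
  by rewrite lee_fin ltW// truncnS_gt.
- have gminE A : gmin (lam A) = (N A)%:R^-1%:E.
    apply: gmin_cst_gap => [|k]; first by rewrite invr_ge0 ltW.
    by rewrite /gap /lam -mulrBl -intrB opprB addrC subrK mul1r.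
  under eq_fun do rewrite gminE -EFinM.
  apply: cvg_EFin; first exact: nearW.
  exact: cvg_div_truncnS.
Qed.
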